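(* Every 4-connected $\{Z_1,K_{1,4}\}$-free graph $G$ with $|V(G)|\ge 9$ contains an $H^2$.
   Context: All graphs are finite and simple. $K_{1,4}$ is the star with 4 leaves. $Z_1$ is the graph obtained from $K_{1,3}$ by adding one edge between two of its leaves. A graph is $\{Z_1,K_{1,4}\}$-free if it has no induced subgraph isomorphic to $Z_1$ or $K_{1,4}$. The square of a graph is obtained by adding edges joining all pairs of vertices at distance two. A graph $G$ contains an $H^2$ if $G$ contains, as a subgraph, the square of some hamiltonian cycle of $G$. *)

(* Defs.v *)
From mathcomp Require Import all_boot.

Set Implicit Arguments.
Unset Strict Implicit.
Unset Printing Implicit Defensive.

Record sgraph (T : finType) := SGraph {
  edge :> rel T;
  edge_sym : symmetric edge;
  edge_irr : irreflexive edge }.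

Section Constructions.
Variable T : finType.

(* The simple graph underlying a relation: forget orientation and loops. *)
Definition underlying_rel (r : rel T) : rel T :=
  fun x y => (x != y) && (r x y || r y x).

Fact underlying_sym (r : rel T) : symmetric (underlying_rel r).
Proof. by move=> x y; rewrite /underlying_rel eq_sym orbC. Qed.

Fact underlying_irr (r : rel T) : irreflexive (underlying_rel r).
Proof. by move=> x; rewrite /underlying_rel eqxx. Qed.

Definition underlying (r : rel T) : sgraph T :=
  SGraph (underlying_sym r) (underlying_irr r).

Definition add_edge (G : sgraph T) (u v : T) : sgraph T :=
  underlying (fun x y => G x y || (x == u) && (y == v)).

Definition distance_two (G : sgraph T) : rel T :=
  fun x y => [&& x != y, ~~ G x y & [exists z, G x z && G z y]].

Definition square (G : sgraph T) : sgraph T :=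
  underlying (fun x y => G x y || distance_two G x y).

Definition cycle_graph (c : seq T) : sgraph T :=
  underlying (fun x y => (x \in c) && (y == next c x)).

Definition subgraph (H G : sgraph T) : Prop := forall x y, H x y -> G x y.

Definition connected_outside (G : sgraph T) (S : {set T}) : Prop :=
  forall x y, x \notin S -> y \notin S ->
    connect (fun u v => [&& u \notin S, v \notin S & G u v]) x y.

Definition k_connected (k : nat) (G : sgraph T) : Prop :=
  k < #|T| /\ forall S : {set T}, #|S| < k -> connected_outside G S.

Definition hamiltonian_cycle (G : sgraph T) (c : seq T) : Prop :=
  [/\ 2 < size c, ucycle G c & forall x, x \in c].

Definition contains_H2 (G : sgraph T) : Prop :=
  exists c : seq T,
    hamiltonian_cycle G c /\ subgraph (square (cycle_graph c)) G.

End Constructions.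

Definition induced_copy (U T : finType) (H : sgraph U) (G : sgraph T) : Prop :=
  exists f : U -> T, injective f /\ forall x y, G (f x) (f y) = H x y.

Definition free (U T : finType) (H : sgraph U) (G : sgraph T) : Prop :=
  ~ induced_copy H G.

(* K_{1,n}, with centre 0 and leaves 1, ..., n. *)
Definition star (n : nat) : sgraph 'I_n.+1 :=
  underlying (fun x y => (x == ord0) && (y != ord0)).

Definition Z1 : sgraph 'I_4 := add_edge (star 3) (inord 1) (inord 2).

(* Main.v *)
(** Take a triangle [t]. A vertex adjacent to exactly one vertex of [t] yields
    an induced paw, and so does a vertex [v] with no neighbour in [t] but with a
    neighbour [w] having two: those two and [w] form a triangle to which [v] is
    pendant. Hence in a connected paw-free graph every vertex outside [t] has
    two neighbours in [t]. Minimum degree 4 and the absence of [K_{1,4}] put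
    every vertex, and then every edge, in a triangle, so non-adjacency is an
    equivalence relation: the graph is complete multipartite, with parts of size
    at most 3.

    List the vertices part by part, the parts of size 3 first, write the list
    column by column into an array with three rows, and read it row by row. For
    [n >= 9] vertices, two vertices of one part end up at cyclic distance at
    least 3, so the resulting cyclic order is a hamiltonian cycle whose square
    lies in the graph. *)

Require Import Defs.
From mathcomp Require Import all_boot.
From mathcomp Require Import zify.

Set Implicit Arguments.
Unset Strict Implicit.
Unset Printing Implicit Defensive.

(** * Degrees, stars and triangles under connectivity and freeness *)

Section Graph.
Variables (T : finType) (G : sgraph T).

Definition neighbours (v : T) : {set T} := [set w | G v w].

Lemma edge_neq x y : G x y -> x != y.
Proof. by apply: contraTneq => ->; rewrite edge_irr. Qed.

(** Deleting fewer than [k] neighbours would cut [v] off from a vertex [w] that [k < #|T|] leaves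
    over. *)
Lemma k_connected_min_degree k v : k_connected k G -> k <= #|neighbours v|.
Proof.
case=> ltkT conn; rewrite leqNgt; apply/negP => ltNk.
have [w] : exists w, w \notin v |: neighbours v.
  apply/existsP; rewrite -negb_forall; apply/negP => /forallP all_in.
  have := leq_trans ltkT (subset_leq_card (introT subsetP (fun w _ => all_in w))).
  by rewrite cardsU1; lia.
rewrite in_setU1 negb_or => /andP[wv wN].
have vN : v \notin neighbours v by rewrite inE edge_irr.
case/connectP: (conn _ ltNk v w vN wN) => [[|u p] /=]; first by move=> _ /eqP; rewrite (negbTE wv).
by case/andP=> /and3P[_]; rewrite inE => /negP.
Qed.

Lemma k_connected_connect k x y : 0 < k -> k_connected k G -> connect G x y.
Proof.
move=> k0 [_ conn]; have S0 : #|@set0 T| < k by rewrite cards0.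
have := conn _ S0 x y; rewrite !inE => /(_ isT isT).
by apply: connect_sub => u v /and3P[_ _ Guv]; exact: connect1.
Qed.

Lemma star_free_independent n v (A : {set T}) : free (star n) G ->
  {in A, forall x, G v x} -> {in A &, forall x y, ~~ G x y} -> #|A| < n.
Proof.
move=> Gfree vA Aindep; rewrite ltnNge; apply/negP => leqnA; apply: Gfree.
have sz : n.+1 <= size (v :: enum A) by rewrite /= -cardE.
have mem i : i < n -> nth v (enum A) i \in A.
  by move=> lti; rewrite -mem_enum mem_nth // -cardE (leq_trans lti).
exists (fun i : 'I_n.+1 => nth v (v :: enum A) i); split.
  move=> i j /eqP; rewrite nth_uniq ?(leq_trans (ltn_ord _) sz) //.
    by move/eqP/val_inj.
  rewrite /= enum_uniq mem_enum andbT; apply: contraT; rewrite negbK => /vA.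
  by rewrite edge_irr.
move=> [[|i] lti] [[|j] ltj]; rewrite /= /underlying_rel -!val_eqE /=.
- by rewrite edge_irr.
- by rewrite vA ?mem.
- by rewrite edge_sym vA ?mem.
- by rewrite andbF; apply: negbTE; rewrite Aindep ?mem.
Qed.

(** Otherwise [w], [x], [y], [v] induce a [Z1], with [w] the centre of the star and [xy] the added
    edge. *)
Lemma Z1_free_triangle w x y v : free Z1 G ->
  G w x -> G w y -> G x y -> G w v -> G v x || G v y.
Proof.
move=> Gfree wx wy xy wv; apply: contraT; rewrite negb_or => /andP[nvx nvy].
case: Gfree; exists (fun i : 'I_4 => nth v [:: w; x; y; v] i); split.
  have xv : x != v by apply: contraNneq nvy => <-.
  have yv : y != v by apply: contraNneq nvx => <-; rewrite edge_sym.
  have u : uniq [:: w; x; y; v].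
    by rewrite /= !inE !negb_or xv yv !edge_neq.
  by move=> i j /eqP; rewrite nth_uniq //= => /eqP/val_inj.
move=> [[|[|[|[|i]]]] lti] // [[|[|[|[|j]]]] ltj] //;
  rewrite /= /underlying_rel /= -?val_eqE /= ?inordK //=;
  rewrite ?edge_irr ?wx ?wy ?wv ?xy ?(negbTE nvx) ?(negbTE nvy) //;
  by rewrite edge_sym ?wx ?wy ?wv ?xy ?(negbTE nvx) ?(negbTE nvy).
Qed.

Lemma triangle_dominates x y z u : free Z1 G ->
  G x y -> G x z -> G y z -> connect G x u -> [|| G x u, G y u | G z u].
Proof.
move=> Gfree xy xz yz /connectP[p xp ->{u}].
(* Besides [a], [v] has a neighbour among [b] and [c]; these two form with [v] a triangle to which
   [w] is attached at [v]. *)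
have step a b c v w : G a b -> G a c -> G b c -> G a v -> G v w ->
    [|| G a w, G b w | G c w].
  move=> ab ac bc av vw; have va : G v a by rewrite edge_sym.
  case/orP: (Z1_free_triangle Gfree ab ac bc av) => [vb|vc].
    by have /orP[] := Z1_free_triangle Gfree va vb ab vw; rewrite edge_sym => ->; rewrite ?orbT.
  by have /orP[] := Z1_free_triangle Gfree va vc ac vw; rewrite edge_sym => ->; rewrite ?orbT.
have [yx zx zy] : [/\ G y x, G z x & G z y] by split; rewrite edge_sym.
elim/last_ind: p xp => [|p w IHp] /=; first by rewrite yx orbT.
rewrite rcons_path last_rcons => /andP[/IHp + vw].
case/or3P=> [xv|yv|zv].
- exact: step xy xz yz xv vw.
- by have := step _ _ _ _ _ yx yz xz yv vw; rewrite orbCA.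
- by have := step _ _ _ _ _ zx zy xy zv vw; case/or3P=> ->; rewrite ?orbT.
Qed.

Definition nonadjacent : rel T := fun x y => ~~ G x y.

Definition part (v : T) : {set T} := [set w | nonadjacent v w].

(** * The graph is complete multipartite with small parts *)

Section FourConnected.
Hypotheses (Gconn : k_connected 4 G) (paw_free : free Z1 G).
Hypothesis claw4_free : free (star 4) G.

Lemma edge_in_triangle x y : G x y -> exists2 z, G x z & G y z.
Proof.
move=> xy.
have [a [b [xa xb ab]]] : exists a b, [/\ G x a, G x b & G a b].
  have degx := k_connected_min_degree x Gconn.
  have [/existsP[a /existsP[b /and3P[]]]|none] :=
    boolP [exists a, exists b, [&& G x a, G x b & G a b]]; first by exists a, b.
  suff : #|neighbours x| < 4 by rewrite ltnNge degx.
  apply: (star_free_independent (v := x) claw4_free) => [a|a b]; rewrite !inE // => xa xb.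
  apply: contra none => ab; apply/existsP; exists a; apply/existsP; exists b.
  exact/and3P.
by case/orP: (Z1_free_triangle paw_free xa xb ab xy); [exists a | exists b].
Qed.

Lemma nonadjacent_equiv : equivalence_rel nonadjacent.
Proof.
apply/equivalence_relP; split=> [x|]; first by rewrite /nonadjacent edge_irr.
suff tr y x z : nonadjacent x y -> nonadjacent y z -> nonadjacent x z.
  move=> x y xy z; apply/idP/idP => [|yz]; last exact: tr xy yz.
  by apply: tr; rewrite /nonadjacent edge_sym.
move=> nxy nyz; apply: contraT; rewrite negbK => xz.
(* [y] has a neighbour in the triangle [x], [z], [t]; if it is [t], there is a second one, [x] or
   [z]. *)
have [t xt zt] := edge_in_triangle xz.
have [tx tz] : G t x /\ G t z by split; rewrite edge_sym.
have nzy : ~~ G z y by rewrite edge_sym.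
have xy : connect G x y by apply: k_connected_connect Gconn.
case/or3P: (triangle_dominates paw_free xz xt zt xy) => [xy'|zy|ty].
- by case/negP: nxy.
- by case/negP: nzy.
- case/orP: (Z1_free_triangle paw_free tx tz xz ty); rewrite edge_sym => e.
    by case/negP: nxy.
  by case/negP: nzy.
Qed.

(** The part is independent and any neighbour [z] of [v] is adjacent to all of it, so it is the leaf
    set of a star at [z]. *)
Lemma card_part v : #|part v| <= 3.
Proof.
have /set0Pn[z] : neighbours v != set0.
  by rewrite -card_gt0 (leq_trans _ (k_connected_min_degree v Gconn)).
rewrite inE => vz; rewrite -ltnS; have eqv := nonadjacent_equiv.
have tr x y : nonadjacent v x -> nonadjacent x y = nonadjacent v y.
  by move=> vx; have [_ ->] := eqv v x y.
apply: (star_free_independent (v := z) claw4_free) => [x|x y]; rewrite !inE.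
  move=> vx; apply: contraT => nzx; suff /negP : nonadjacent v z by rewrite vz.
  by rewrite -(tr x z vx) /nonadjacent edge_sym.
by move=> vx vy; have := tr x y vx; rewrite vy.
Qed.

End FourConnected.

End Graph.

(** * Listing a finite set class by class *)

Section BlockOrder.
Variables (T : finType) (e : rel T).
Hypothesis e_equiv : equivalence_rel e.

(* Listed column by column in an array with three rows, two equivalent elements
   share a column, or are the last of a column and the first of the next. *)
Definition block_sorted (x0 : T) (s : seq T) : Prop :=
  forall i j, i < j < size s -> e (nth x0 s i) (nth x0 s j) ->
    (j == i.+1) || (j == i.+2) && (3 %| i).

(** Induction removes one class at a time. The divisibility clause carries the induction: if the
    last class has size 3, so have all others, and it starts at a multiple of 3. *)
Lemma ex_block_sorted (x0 : T) (A : {set T}) :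
    (forall x y, e x y -> x \in A -> y \in A) ->
    (forall x, #|[set y | e x y]| <= 3) ->
  exists s, [/\ uniq s, s =i A, block_sorted x0 s &
    (forall x, x \in A -> #|[set y | e x y]| = 3) -> 3 %| size s].
Proof.
move=> Acl le3; have [m] := ubnP #|A|; elim: m A Acl => // m IHm A Acl ltAm.
have e_refl x : e x x by have [] := e_equiv x x x.
have e_tr x y z : e x y -> e x z = e y z by have [_] := e_equiv x y z.
have e_sym x y : e x y = e y x.
  by apply/idP/idP => exy; rewrite -(e_tr _ _ _ exy).
have [->|[a aA]] := set_0Vmem A.
  by exists [::]; split=> // [x|i j]; rewrite ?inE // andbC.
(* A smallest class goes last, so every class of size 3 starts a column. *)
case: (arg_minnP (fun x => #|[set y | e x y]|) aA) => b bA bmin.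
set B := [set y | e b y] in bmin.
have BA : B \subset A by apply/subsetP => x; rewrite inE => /Acl ->.
have [||s [us sE sb s3]] := IHm (A :\: B).
- move=> x y exy; rewrite !inE => /andP[nbx /(Acl _ _ exy) ->].
  by rewrite andbT e_sym -(e_tr _ _ _ exy) e_sym.
- suff: #|A :\: B| < #|A| by move=> lt; rewrite -ltnS (leq_trans _ ltAm) // ltnS.
  by apply/proper_card/properP; split; [exact: subsetDl | exists b; rewrite ?inE ?e_refl].
exists (s ++ enum B); split.
- rewrite cat_uniq us enum_uniq andbT; apply/hasPn => x.
  by rewrite mem_enum /= sE in_setD => ->.
- move=> x; rewrite mem_cat mem_enum sE in_setD.
  by case: (boolP (x \in B)) => [/(subsetP BA) ->|_]; rewrite ?orbF.
- move=> i j; have -> : size (s ++ enum B) = size s + #|B| by rewrite size_cat cardE.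
  case/andP=> ltij ltj.
  rewrite !nth_cat; case: (ltnP j (size s)) => [ltjs|lesj].
    by rewrite (ltn_trans ltij ltjs); apply: sb; rewrite ltij.
  have jB : nth x0 (enum B) (j - size s) \in B by rewrite -mem_enum mem_nth // -cardE ltn_subLR.
  case: (ltnP i (size s)) => [ltis|lesi].
    move=> eij; have := mem_nth x0 ltis; rewrite sE in_setD => /andP[/negP[]].
    by move: jB; rewrite /B 2!in_set !(e_sym b) (e_tr _ _ _ eij).
  move=> _; have leB3 := le3 b; rewrite -/B in leB3.
  have [ltB3|geB3] := ltnP #|B| 3; first lia.
  suff : 3 %| size s by lia.
  apply: s3 => x; rewrite in_setD => /andP[_ /bmin leBx].
  by apply/eqP; rewrite eqn_leq le3 (leq_trans geB3).
- move=> all3; rewrite size_cat -cardE all3 // dvdn_addl //.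
  by apply: s3 => x; rewrite in_setD => /andP[_ /all3].
Qed.

End BlockOrder.

(** * Arithmetic of the row by row reading *)

Lemma modn_wrap m n : m < n + n -> m %% n = if m < n then m else m - n.
Proof.
move=> ltm; case: ltnP => [/modn_small //|le].
by rewrite -{1}(subnK le) modnDr modn_small //; lia.
Qed.

(* The place, in an [n]-entry list written column by column into three rows, of
   the [q]-th entry of the row by row reading. *)
Definition row_reading (n q : nat) : nat :=
  let r0 := (n + 2) %/ 3 in let r1 := (n + 1) %/ 3 in
  if q < r0 then 3 * q
  else if q < r0 + r1 then 3 * (q - r0) + 1 else 3 * (q - r0 - r1) + 2.

Lemma row_reading_lt n q : q < n -> row_reading n q < n.
Proof. by rewrite /row_reading /=; do ?case: ifP; lia. Qed.

Lemma row_reading_inj n p q :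
  p < n -> q < n -> row_reading n p = row_reading n q -> p = q.
Proof. by rewrite /row_reading /=; do ?case: ifP; lia. Qed.

(** Within a row the places differ by 3 or 6. Across a row end they can differ by 2, as 3 and 1 do
    for [n = 9], but then the smaller one is not a multiple of 3. *)
Lemma row_reading_far n q d i j : 8 < n -> q < n -> 0 < d < 3 ->
  let k := row_reading n q in let l := row_reading n ((q + d) %% n) in
  (k, l) = (i, j) \/ (l, k) = (i, j) ->
  i < j -> ~~ ((j == i.+1) || (j == i.+2) && (3 %| i)).
Proof.
move=> n9 ltqn d3 /=; rewrite modn_wrap; last lia.
by rewrite /row_reading /= => -[] [<- <-]; do ?case: ifP; lia.
Qed.

Lemma next_nth_mod (T : eqType) (x0 : T) (c : seq T) q : uniq c ->
  q < size c -> next c (nth x0 c q) = nth x0 c (q.+1 %% size c).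
Proof.
case: c => // y c uc ltq; rewrite next_nth mem_nth // index_uniq //.
have [ltq'|leq'] := ltnP q.+1 (size (y :: c)).
  by rewrite modn_small //= (set_nth_default x0).
(* At the last entry [next] reads past the tail and returns its default, the head [y]. *)
have -> : q.+1 = size (y :: c) by apply/eqP; rewrite eqn_leq ltq.
by rewrite modnn nth_default.
Qed.

(** * Hamiltonian cycles whose square lies in the graph *)

Section CycleSquare.
Variables (T : finType) (G : sgraph T).

Lemma contains_H2_next (c : seq T) : 2 < size c -> uniq c ->
    (forall x, x \in c) ->
    (forall x, G x (next c x) && G x (next c (next c x))) ->
  contains_H2 G.
Proof.
move=> c2 uc cT Gc.
have nextI : injective (next c) := can_inj (prev_next uc).
exists c; split.
  split=> //; rewrite /ucycle uc andbT.
  by apply: cycle_from_next => // x _; case/andP: (Gc x).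
have G1 x : G x (next c x) by case/andP: (Gc x).
have G2 x : G x (next c (next c x)) by case/andP: (Gc x).
have C x y : cycle_graph c x y -> y = next c x \/ x = next c y.
  by rewrite /= /underlying_rel !cT => /andP[_ /orP[]/eqP]; [left | right].
suff half x y : cycle_graph c x y || distance_two (cycle_graph c) x y -> G x y.
  by move=> x y /andP[_ /orP[/half //|/half]]; rewrite edge_sym.
case/orP=> [/C[->|->] //|]; first by rewrite edge_sym.
case/and3P=> + _ /existsP[z /andP[/C xz /C yz]].
(* Two steps in the same direction give a second successor; in opposite directions they give
   [x = y], which is excluded. *)
case: xz yz => -> [] => [-> _|/nextI -> /eqP|-> /eqP|-> _] //.
by rewrite edge_sym.
Qed.

Lemma contains_H2_row_reading (s : seq T) (x0 : T) : 8 < size s -> uniq s ->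
    (forall x, x \in s) -> block_sorted (nonadjacent G) x0 s ->
  contains_H2 G.
Proof.
move=> n9 us sT sb; set n := size s in n9.
pose c := mkseq (fun q => nth x0 s (row_reading n q)) n.
have uc : uniq c.
  apply/(uniqP x0) => p q; rewrite !inE size_mkseq => ltp ltq.
  rewrite !nth_mkseq // => /eqP; rewrite nth_uniq ?row_reading_lt // => /eqP.
  exact: row_reading_inj.
have szc : size c = n by rewrite size_mkseq.
have cT x : x \in c.
  suff cs : {subset c <= s} by have [_ ->] := uniq_min_size uc cs (eq_leq (esym szc)).
  by move=> _ /mapP[q + ->]; rewrite mem_iota => ltq; rewrite mem_nth ?row_reading_lt.
have next_c q : q < n -> next c (nth x0 c q) = nth x0 c ((q + 1) %% n).
  by move=> ltq; rewrite next_nth_mod ?szc // addn1.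
have far q d : q < n -> 0 < d < 3 -> G (nth x0 c q) (nth x0 c ((q + d) %% n)).
  move=> ltq d3; have ltq' : (q + d) %% n < n by rewrite ltn_mod; lia.
  rewrite !nth_mkseq //; apply: contraT => nG.
  have H := row_reading_far n9 ltq d3.
  case: (ltngtP (row_reading n q) (row_reading n ((q + d) %% n))) => [lt|gt|eq].
  - have /negP[] := H _ _ (or_introl erefl) lt.
    by apply: sb => //; rewrite lt row_reading_lt.
  - have /negP[] := H _ _ (or_intror erefl) gt.
    by apply: sb; rewrite ?gt ?row_reading_lt // /nonadjacent edge_sym.
  (* Equal places would mean that a shift by [d < n] fixes [q]. *)
  - move/(row_reading_inj ltq ltq'): eq; rewrite modn_wrap; last lia.
    by case: ifP; lia.
apply: (@contains_H2_next c) => // [|x]; first by rewrite szc; lia.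
have [q ltq ->] : exists2 q, q < n & x = nth x0 c q.
  by exists (index x c); rewrite ?nth_index // -szc index_mem.
rewrite !next_c // ?modnDml -?addnA ?far //; by rewrite ltn_mod; lia.
Qed.

End CycleSquare.

Theorem theorem5 (T : finType) (G : sgraph T) :
  k_connected 4 G -> free Z1 G -> free (star 4) G -> 9 <= #|T| ->
  contains_H2 G.
Proof.
move=> Gconn paw_free claw4_free T9.
have /card_gt0P[x0 _] : 0 < #|T| by exact: leq_trans T9.
have eqv := nonadjacent_equiv Gconn paw_free claw4_free.
have [s [us sT sb _]] :=
  ex_block_sorted eqv x0 (A := setT) (fun _ y _ _ => in_setT y)
  (card_part Gconn paw_free claw4_free).
apply: (@contains_H2_row_reading _ _ s x0) => //.
  by rewrite -(card_uniqP us) (eq_card sT) cardsT.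
by move=> x; rewrite sT inE.
Qed.
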